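(* Let $\mathcal H=(V,E)$ be a locally finite simple hypergraph. Let $x,y\in V$ with $x\sim_{\mathcal H}y$. Then the function $\alpha\mapsto\kappa_{\alpha}^{\mathcal H}(x,y)$ is concave and piecewise linear over $[0,1]$ with at most $3$ linear parts. Furthermore, $\kappa_{\alpha}^{\mathcal H}(x,y)$ is linear (as a function of $\alpha$) on the interval $\left[\frac12,1\right]$.
   Context: A hypergraph $\mathcal H=(V,E)$ consists of a vertex set $V$ and a set $E$ of finite subsets of $V$ (hyperedges). It is simple if $|e|\ge 2$ for every $e\in E$ and, for distinct $e,f\in E$, neither $e\subseteq f$ nor $f\subseteq e$. It is locally finite if each vertex belongs to only finitely many hyperedges; every hyperedge is finite. The incidence degree of $x\in V$ is $d_x^{\mathcal H}:=\#\{e\in E: x\in e\}$. Two distinct vertices are adjacent, $x\sim_{\mathcal H}y$, if they lie in a common hyperedge. A hyperpath joining $u,v\in V$ is a finite sequence $(e_1,\dots,e_l)$ of distinct hyperedges with $u\in e_1$, $v\in e_l$ and $e_j\cap e_{j+1}\ne\varnothing$ for $1\le j\le l-1$. The distance $d_{\mathcal H}(u,v)$ is the minimum number $l$ of hyperedges in a hyperpath joining $u$ and $v$ ($\infty$ if none exists), and $d_{\mathcal H}(u,u)=0$. For finitely supported probability measures $\mu_1,\mu_2$ on $V$, the $1$-Wasserstein distance is $$W_1^{\mathcal H}(\mu_1,\mu_2):=\inf_{\pi}\sum_{u\in V}\sum_{v\in V}d_{\mathcal H}(u,v)\,\pi(u,v)$$ (with $\infty\cdot 0=0$), where the infimum is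 over all $\pi:V\times V\to[0,1]$ with $\sum_{w}\pi(u,w)=\mu_1(u)$ and $\sum_{w}\pi(w,v)=\mu_2(v)$ for all $u,v\in V$. For $x\in V$ and idleness $\alpha\in[0,1]$, the probability measure $\mu_x^\alpha$ on $V$ is defined by $\mu_x^\alpha(x)=\alpha$; $\mu_x^\alpha(z)=\frac{1-\alpha}{d_x^{\mathcal H}}\sum_{e\in E,\ e\supseteq\{x,z\}}\frac{1}{|e|-1}$ if $z\sim_{\mathcal H}x$; and $\mu_x^\alpha(z)=0$ otherwise. The $\alpha$-Ollivier--Ricci curvature is $$\kappa_\alpha^{\mathcal H}(x,y):=1-\frac{W_1^{\mathcal H}(\mu_x^\alpha,\mu_y^\alpha)}{d_{\mathcal H}(x,y)}.$$ ''Linear'' on an interval means affine in $\alpha$ there; ''piecewise linear over $[0,1]$ with at most $k$ linear parts'' means that $[0,1]$ can be divided into at most $k$ consecutive closed intervals on each of which the function is affine. *)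

(* Defs.v *)
From mathcomp Require Import all_boot all_order all_algebra finmap.
From mathcomp Require Import all_classical all_reals all_analysis.

Set Implicit Arguments.
Unset Strict Implicit.
Unset Printing Implicit Defensive.

Import Order.TTheory GRing.Theory Num.Theory.

Local Open Scope classical_set_scope.
Local Open Scope ring_scope.

(* The vertex set is the whole (possibly infinite) type V; a hypergraph on V is
   given by its set of hyperedges, each of which is finite by typing. *)
Definition hypergraph (V : choiceType) := set {fset V}.

Section Hypergraph.
Variables (V : choiceType) (H : hypergraph V).

Definition simple_hypergraph : Prop :=
  (forall e, H e -> (2 <= #|` e|)%N) /\
  (forall e f, H e -> H f -> e <> f -> ~ (e `<=` f)%fset).

Definition incident (x : V) : set {fset V} := [set e | H e /\ x \in e].

Definition locally_finite_hypergraph : Prop :=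
  forall x, finite_set (incident x).

(* Meaningful when [incident x] is finite; [fset_set] sends infinite sets to
   the empty one. *)
Definition hdegree (x : V) : nat := #|` fset_set (incident x)|.

Definition hadjacent (x y : V) : Prop :=
  x <> y /\ exists2 e, H e & x \in e /\ y \in e.

Definition hyperpath (u v : V) (p : seq {fset V}) : Prop :=
  if p is e :: s then
    [/\ forall f, f \in p -> H f, uniq p, u \in e, v \in last e s
      & path (fun f g => (f `&` g)%fset != fset0) e s]
  else False.

Variable R : realType.

(* An infimum of natural numbers, hence a minimum as soon as a hyperpath
   exists; it is +oo otherwise. *)
Definition hdist (u v : V) : \bar R :=
  if u == v then 0%E
  else ereal_inf [set (size p)%:R%:E | p in hyperpath u v].

Definition coupling (mu1 mu2 : V -> R) (pi : V -> V -> R) : Prop :=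
  [/\ forall u v, 0 <= pi u v <= 1,
      forall u, (\esum_(w in [set: V]) (pi u w)%:E = (mu1 u)%:E)%E
    & forall v, (\esum_(w in [set: V]) (pi w v)%:E = (mu2 v)%:E)%E].

(* Probability measures on V are represented by their mass functions. In
   [\bar R] one has +oo * 0 = 0. *)
Definition wasserstein1 (mu1 mu2 : V -> R) : \bar R :=
  ereal_inf
    [set (\esum_(u in [set: V]) \esum_(v in [set: V])
            (hdist u v * (pi u v)%:E))%E | pi in coupling mu1 mu2].

Definition lazy_walk (a : R) (x z : V) : R :=
  if z == x then a
  else if `[< hadjacent x z >] then
    (1 - a) / (hdegree x)%:R *
    \sum_(e \in [set e | incident x e /\ z \in e]) (#|` e|%:R - 1 : R)^-1
  else 0.

Definition ollivier_ricci (a : R) (x y : V) : \bar R :=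
  (1 - wasserstein1 (lazy_walk a x) (lazy_walk a y) / hdist x y)%E.

End Hypergraph.

Section RealFunctions.
Variable R : realType.
Implicit Types (f : R -> R) (a b : R).

Definition affine_on a b f : Prop :=
  exists p q : R, {in `[a, b], forall t, f t = p * t + q}.

(* For [itv_partition a b s], the points a :: s are strictly increasing from a
   to b and cut [a, b] into [size s] intervals. *)
Definition piecewise_affine (k : nat) a b f : Prop :=
  exists s : seq R,
    [/\ itv_partition a b s, (size s <= k)%N
      & forall i, (i < size s)%N ->
          affine_on (nth b (a :: s) i) (nth b (a :: s) i.+1) f].

Definition concave_on a b f : Prop :=
  convex_function `[a, b]%classic (fun t : R^o => - f t : R^o).

End RealFunctions.

(* Main.v *)
Require Import Defs.
From mathcomp Require Import all_boot all_order all_algebra finmap ring lra zify.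
From mathcomp Require Import all_classical all_reals all_analysis.

(* The lazy measure at x is a delta_x + (1 - a) m_x.  By Kantorovich duality with
   integer-valued potentials, W_1 is the maximum over 1-Lipschitz f of
   a (f x - f y) + (1 - a) \int f d(m_x - m_y), where f x - f y is -1, 0 or 1;
   maximizing the integral for each of these three values exhibits W_1 as the
   maximum of three functions affine in a.  It is therefore convex, and since
   any two of the three affine functions are strictly ordered at a = 1, it has
   at most three linear parts.  Any potential can be changed into one with
   f x - f y = 1 while the integral decreases by at most 1 - (f x - f y), so that
   the corresponding affine function is already the largest at a = 1/2.

   Duality itself is obtained from an integer potential that is optimal: Hall's
   condition, with real weights, then holds for the pairs where its Lipschitz
   bound is attained, and yields a coupling supported on these pairs. *)

Set Implicit Arguments.
Unset Strict Implicit.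

Import Order.TTheory GRing.Theory Num.Theory.
Local Open Scope ring_scope.

(** * Hall's theorem with real weights *)

Definition nbhood (S T : finType) (G : S -> T -> bool) (A : {set S}) : {set T} :=
  [set v | [exists u in A, G u v]].

Lemma nbhoodP (S T : finType) (G : S -> T -> bool) (A : {set S}) v :
  reflect (exists2 u, u \in A & G u v) (v \in nbhood G A).
Proof. by rewrite inE; apply: (iffP exists_inP). Qed.

Lemma sum_on_setI (R : nmodType) (I : finType) (A B : {set I}) (F : I -> R) :
  \sum_(i in B) (if i \in A then F i else 0) = \sum_(i in A :&: B) F i.
Proof.
rewrite -big_mkcondr; apply: eq_bigl => i.
by rewrite !inE andbC.
Qed.

Lemma sum_subr_delta (R : zmodType) (I : finType) (A : {set I}) (i0 : I) (F : I -> R) t :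
  \sum_(i in A) (F i - (if i == i0 then t else 0)) =
  \sum_(i in A) F i - (if i0 \in A then t else 0).
Proof.
rewrite sumrB -big_mkcondr; congr (_ - _).
case: ifP => i0A; last first.
  by rewrite big1 // => i /andP[iA /eqP ii0]; rewrite -ii0 iA in i0A.
by rewrite (big_pred1 i0) // => i; rewrite /=; case: eqP => [->|]; rewrite ?i0A ?andbF.
Qed.

(** Induction on the total size of the supports of [p] and [q]. Mass is pushed along an edge (u, v)
    until an endpoint is exhausted or some set avoiding u and adjacent to v becomes tight. A tight
    set splits the problem in two, and both halves have smaller supports: the first loses u, the
    second loses v. *)
Lemma weighted_hall (R : realFieldType) (S T : finType) (G : S -> T -> bool)
    (p : S -> R) (q : T -> R) :
    (forall u, 0 <= p u) -> (forall v, 0 <= q v) ->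
    (forall A : {set S}, \sum_(u in A) p u <= \sum_(v in nbhood G A) q v) ->
  exists pi : S -> T -> R,
    [/\ forall u v, 0 <= pi u v,
        forall u v, ~~ G u v -> pi u v = 0,
        forall u, \sum_v pi u v = p u
      & forall v, \sum_u pi u v <= q v].
Proof.
pose supp (I : finType) (r : I -> R) := [set i | r i != 0].
have [n] := ubnP (#|supp S p| + #|supp T q|)%N.
have supp_lt (I : finType) (r r' : I -> R) i :
    (forall j, r j = 0 -> r' j = 0) -> r i != 0 -> r' i = 0 ->
  (#|supp I r'| < #|supp I r|)%N.
  move=> rr' ri ri'; apply: proper_card; apply/properP; split.
    by apply/fintype.subsetP => j; rewrite !inE; apply: contra_neq => /rr'.
  by exists i; rewrite !inE ?ri // ri' eqxx.
have supp_le (I : finType) (r r' : I -> R) :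
    (forall j, r j = 0 -> r' j = 0) -> (#|supp I r'| <= #|supp I r|)%N.
  move=> rr'; apply: subset_leq_card; apply/fintype.subsetP => j.
  by rewrite !inE; apply: contra_neq => /rr'.
elim: n p q => [//|n IHn] p q.
rewrite ltnS => leN p_ge0 q_ge0 hall.
pose N := nbhood G.
have [/existsP[u pu_neq0]|/existsPn p0] := boolP [exists u, p u != 0]; last first.
  exists (fun _ _ => 0); split=> // [u|v]; last by rewrite big1.
  by rewrite big1 //; apply/esym/eqP; rewrite -[_ == _]negbK p0.
have pu_gt0 : 0 < p u by rewrite lt_def pu_neq0 p_ge0.
have [v Guv qv_gt0] : exists2 v, G u v & 0 < q v.
  have [/exists_inP[v Nv qv]|/exists_inPn qN] :=
      boolP [exists v in N [set u], 0 < q v].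
    by exists v => //; have /nbhoodP[w /finset.set1P ->] := Nv.
  have := hall [set u]; rewrite big_set1 big1 => [|v /qN].
    by rewrite leNgt pu_gt0.
  by rewrite -leNgt => qv; apply/eqP; rewrite eq_le qv q_ge0.
have NS (A B : {set S}) : A \subset B -> N A \subset N B.
  move=> /fintype.subsetP AB; apply/fintype.subsetP => w /nbhoodP[z zA Gzw].
  by apply/nbhoodP; exists z => //; apply: AB.
pose slack (A : {set S}) := \sum_(w in N A) q w - \sum_(z in A) p z.
pose P (A : {set S}) := (u \notin A) && (v \in N A).
pose p' t z := p z - (if z == u then t else 0).
pose q' t w := q w - (if w == v then t else 0).
(* Pushing t units of mass along the edge (u, v) keeps Hall's condition as long
   as t is at most the slack of every set avoiding u and adjacent to v. *)
have push t : t <= p u -> t <= q v -> (forall A, P A -> t <= slack A) ->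
    [/\ forall z, 0 <= p' t z, forall w, 0 <= q' t w &
        forall A : {set S}, \sum_(z in A) p' t z <= \sum_(w in N A) q' t w].
  move=> tp tq tslack; split.
  - by move=> z; rewrite /p'; case: eqP => [->|]; rewrite ?subr_ge0 ?subr0.
  - by move=> w; rewrite /q'; case: eqP => [->|]; rewrite ?subr_ge0 ?subr0.
  move=> A; rewrite !sum_subr_delta.
  have [uA|uA] := boolP (u \in A).
    rewrite ifT; last by apply/nbhoodP; exists u.
    by rewrite lerD2r hall.
  rewrite subr0; have [vA|_] := ifPn; last by rewrite subr0 hall.
  by have := tslack A; rewrite /P uA vA => /(_ isT); rewrite /slack; lra.
have delta_row (t : R) z : \sum_w (if (z == u) && (w == v) then t else 0) =
                     (if z == u then t else 0).
  by case: eqP => _ /=; [rewrite -big_mkcond big_pred1_eq | rewrite big1].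
have delta_col (t : R) w : \sum_z (if (z == u) && (w == v) then t else 0) =
                     (if w == v then t else 0).
  case: eqP => _ /=; last by rewrite big1 // => z; rewrite andbF.
  by under eq_bigr do rewrite andbT; rewrite -big_mkcond big_pred1_eq.
pose m := Num.min (p u) (q v).
have m_le_p : m <= p u by rewrite ge_min lexx.
have m_le_q : m <= q v by rewrite ge_min lexx orbT.
have [/existsP[A0 /andP[PA0 slA0]]|/existsPn noslack] :=
    boolP [exists A, P A && (slack A < m)]; last first.
  have m_gt0 : 0 < m by rewrite lt_min pu_gt0.
  have [||A PA|p'_ge0 q'_ge0 hall'] := push m => //.
    by move: (noslack A); rewrite PA /= -leNgt.
  have pp' z : p z = 0 -> p' m z = 0.
    by rewrite /p'; case: eqP => [-> pu0|_ ->]; [rewrite pu0 eqxx in pu_neq0|rewrite subr0].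
  have qq' w : q w = 0 -> q' m w = 0.
    by rewrite /q'; case: eqP => [-> qv0|_ ->]; [rewrite qv0 ltxx in qv_gt0|rewrite subr0].
  have [//|pi [pi_ge0 piG pi_row pi_col]] := IHn _ _ _ p'_ge0 q'_ge0 hall'.
    apply: leq_trans leN; have [pq|qp] := leP (p u) (q v).
      rewrite -addSn leq_add ?supp_le // (supp_lt _ _ _ u) //.
      by rewrite /p' eqxx /m (min_idPl pq) subrr.
    rewrite -addnS leq_add ?supp_le // (supp_lt _ _ _ v) // ?gt_eqF //.
    by rewrite /q' eqxx /m (min_idPr (ltW qp)) subrr.
  exists (fun z w => pi z w + (if (z == u) && (w == v) then m else 0)); split.
  - by move=> z w; rewrite addr_ge0 //; case: ifP => // _; apply: ltW.
  - move=> z w nG; rewrite piG // add0r; case: ifP => // /andP[/eqP zu /eqP wv].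
    by rewrite zu wv Guv in nG.
  - by move=> z; rewrite big_split /= pi_row delta_row /p' subrK.
  - by move=> w; rewrite big_split /= delta_col; have := pi_col w; rewrite /q' lerBrDr.
(* Here [m] is too much to push. Pushing exactly the least slack keeps Hall's condition and makes
   the minimizing set [A] tight, which separates [A] and [N A] from their complements. *)
case: (arg_minP slack PA0) => A /andP[uA vA] slA_min.
set t := slack A.
have t_ltm : t < m by apply: le_lt_trans slA0; apply: slA_min.
have t_ge0 : 0 <= t by rewrite subr_ge0 hall.
have [||//|p'_ge0 q'_ge0 hall'] := push t; rewrite ?(le_trans (ltW t_ltm)) //.
have tight : \sum_(z in A) p' t z = \sum_(w in N A) q' t w.
  by rewrite !sum_subr_delta (negbTE uA) vA /t /slack; ring.
pose p1 z := if z \in A then p' t z else 0.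
pose q1 w := if w \in N A then q' t w else 0.
pose p2 z := if z \in ~: A then p' t z else 0.
pose q2 w := if w \in ~: N A then q' t w else 0.
have pp' z : p z = 0 -> p' t z = 0.
  by rewrite /p'; case: eqP => [-> pu0|_ ->]; [rewrite pu0 eqxx in pu_neq0|rewrite subr0].
have qq' w : q w = 0 -> q' t w = 0.
  by rewrite /q'; case: eqP => [-> qv0|_ ->]; [rewrite qv0 ltxx in qv_gt0|rewrite subr0].
have q'_le (B C : {set T}) : B \subset C -> \sum_(w in B) q' t w <= \sum_(w in C) q' t w.
  move=> /fintype.subsetP BC; rewrite [leLHS]big_mkcond [leRHS]big_mkcond /=.
  by apply: ler_sum => w _; case: ifPn => [/BC -> //|_]; case: ifP.
have [||||pi1 [pi1_ge0 pi1G pi1_row pi1_col]] := IHn p1 q1.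
- apply: leq_trans leN; rewrite -addSn leq_add //.
    apply: (supp_lt _ _ _ u) => // [z|]; last by rewrite /p1 (negbTE uA).
    by rewrite /p1; case: ifP => // _ /pp'.
  by apply: supp_le => w; rewrite /q1; case: ifP => // _ /qq'.
- by move=> z; rewrite /p1; case: ifP.
- by move=> w; rewrite /q1; case: ifP.
- move=> B; rewrite !sum_on_setI (le_trans (hall' _)) // q'_le //.
  by rewrite finset.subsetI !NS ?finset.subsetIl ?finset.subsetIr.
have [||||pi2 [pi2_ge0 pi2G pi2_row pi2_col]] := IHn p2 q2.
- apply: leq_trans leN; rewrite -addnS leq_add //.
    by apply: supp_le => z; rewrite /p2; case: ifP => // _ /pp'.
  apply: (supp_lt _ _ _ v) => // [w||]; last by rewrite /q2 inE vA.
    by rewrite /q2; case: ifP => // _ /qq'.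
  by rewrite gt_eqF.
- by move=> z; rewrite /p2; case: ifP.
- by move=> w; rewrite /q2; case: ifP.
(* For the complements, the tight equality for [A] is added to both sides; what remains is Hall's
   condition for the union of [A] and [B]. *)
- move=> B; rewrite !sum_on_setI -(lerD2l (\sum_(z in A) p' t z)) {2}tight.
  have splitU (I : finType) (F : I -> R) (C D : {set I}) :
      \sum_(i in C) F i + \sum_(i in ~: C :&: D) F i = \sum_(i in C :|: D) F i.
    rewrite [RHS](big_setID C) /= finset.setUK; congr (_ + _); apply: eq_bigl => i.
    by rewrite !inE; case: (i \in C).
  rewrite !splitU (le_trans (hall' _)) // q'_le //.
  apply/fintype.subsetP => w /nbhoodP[z /finset.setUP[zA|zB] Gzw]; rewrite inE; apply/orP.
    by left; apply/nbhoodP; exists z.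
  by right; apply/nbhoodP; exists z.
exists (fun z w => pi1 z w + pi2 z w + (if (z == u) && (w == v) then t else 0)).
split.
- by move=> z w; rewrite !addr_ge0 //; case: ifP.
- move=> z w nG; rewrite pi1G // pi2G // !add0r.
  by case: ifP => // /andP[/eqP zu /eqP wv]; rewrite zu wv Guv in nG.
- move=> z; rewrite !big_split /= pi1_row pi2_row delta_row /p1 /p2 inE /p'.
  by case: (z \in A); rewrite /= ?addr0 ?add0r subrK.
- move=> w; rewrite !big_split /= delta_col.
  have := lerD (pi1_col w) (pi2_col w); rewrite /q1 /q2 finset.in_setC /q'.
  by case: (w \in N A); rewrite /= ?addr0 ?add0r lerBrDr.
Qed.

(** * Integer potentials and optimal transport plans *)

Definition lipschitz_potential (T : finType) (d : T -> T -> nat) (f : T -> int) :=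
  forall u v, f u - f v <= (d u v)%:Z.

Definition integral_against (R : numDomainType) (T : finType) (f : T -> int)
    (nu : T -> R) : R :=
  \sum_u (f u)%:~R * nu u.

Definition transport_plan (R : numDomainType) (T : finType) (mu1 mu2 : T -> R)
    (pi : T -> T -> R) :=
  [/\ forall u v, 0 <= pi u v, forall u, \sum_v pi u v = mu1 u
    & forall v, \sum_u pi u v = mu2 v].

Definition transport_cost (R : numDomainType) (T : finType) (d : T -> T -> nat)
    (pi : T -> T -> R) : R :=
  \sum_u \sum_v (d u v)%:R * pi u v.


Lemma integral_against_plan (R : numDomainType) (T : finType) (f : T -> int)
    (mu1 mu2 : T -> R) (pi : T -> T -> R) :
  transport_plan mu1 mu2 pi ->
  integral_against f (fun u => mu1 u - mu2 u) =
  \sum_u \sum_v (f u - f v)%:~R * pi u v.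
Proof.
move=> [_ row col].
under [RHS]eq_bigr do under eq_bigr do rewrite intrB mulrBl.
under [RHS]eq_bigr do rewrite sumrB.
rewrite sumrB [X in _ = _ - X]exchange_big /= -sumrB.
by apply: eq_bigr => u _; rewrite -!mulr_sumr row col mulrBr.
Qed.

Lemma weak_duality (R : numDomainType) (T : finType) (d : T -> T -> nat) (f : T -> int)
    (mu1 mu2 : T -> R) (pi : T -> T -> R) :
  lipschitz_potential d f -> transport_plan mu1 mu2 pi ->
  integral_against f (fun u => mu1 u - mu2 u) <= transport_cost d pi.
Proof.
move=> lipf plan; rewrite (integral_against_plan f plan); have [pi_ge0 _ _] := plan.
by do 2!apply: ler_sum => ? _; rewrite ler_wpM2r // -[leRHS]/((_%:Z)%:~R) ler_int.
Qed.

(* If f is optimal, the pairs where its Lipschitz bound is attained form a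
   preorder, and raising f by 1 on a set closed under this preorder keeps it
   Lipschitz: optimality is then Hall's condition for this preorder. *)
Lemma optimal_potential_plan (R : realFieldType) (T : finType) (d : T -> T -> nat)
    (mu1 mu2 : T -> R) (f : T -> int) :
    (forall u, d u u = 0%N) -> (forall u v w, (d u w <= d u v + d v w)%N) ->
    (forall u, 0 <= mu1 u) -> (forall u, 0 <= mu2 u) ->
    \sum_u mu1 u = \sum_u mu2 u ->
    lipschitz_potential d f ->
    (forall g, lipschitz_potential d g ->
       integral_against g (fun u => mu1 u - mu2 u) <=
       integral_against f (fun u => mu1 u - mu2 u)) ->
  exists2 pi, transport_plan mu1 mu2 pi &
    transport_cost d pi = integral_against f (fun u => mu1 u - mu2 u).
Proof.
move=> d0 dtri mu1_ge0 mu2_ge0 mass lipf fmax.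
pose G u v := f u - f v == (d u v)%:Z.
have Gxx u : G u u by rewrite /G subrr d0.
have Gtrans u v w : G u v -> G v w -> G u w.
  rewrite /G => /eqP Guv /eqP Gvw; have := lipf u w; have := dtri u v w; lia.
have hall (A : {set T}) : \sum_(u in A) mu1 u <= \sum_(v in nbhood G A) mu2 v.
  set N := nbhood G A.
  have AN : A \subset N by apply/fintype.subsetP => u uA; apply/nbhoodP; exists u.
  have Nclosed u v : u \in N -> G u v -> v \in N.
    by move=> /nbhoodP[w wA Gwu] Guv; apply/nbhoodP; exists w => //; apply: Gtrans Guv.
  pose g u := f u + (u \in N)%:Z.
  have lipg : lipschitz_potential d g.
    move=> u v; rewrite /g; have := lipf u v.
    have [uN|_] := boolP (u \in N); have [vN|vN] := boolP (v \in N) => /=; try lia.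
    have /eqP : ~~ G u v by apply: contra vN; apply: Nclosed.
    by lia.
  have : integral_against g (fun u => mu1 u - mu2 u) =
         integral_against f (fun u => mu1 u - mu2 u) + \sum_(u in N) (mu1 u - mu2 u).
    rewrite /integral_against [X in _ + X]big_mkcond -big_split /=; apply: eq_bigr => u _.
    by rewrite /g intrD mulrDl; case: (u \in N); rewrite ?mul1r ?mul0r.
  have leN : \sum_(u in A) mu1 u <= \sum_(u in N) mu1 u.
    rewrite [leLHS]big_mkcond [leRHS]big_mkcond /=; apply: ler_sum => u _.
    by case: ifPn => [/(fintype.subsetP AN) -> //|_]; case: ifP.
  by rewrite sumrB => E; have := fmax g lipg; rewrite E; move: leN; lra.
have [pi [pi_ge0 piG row col]] := weighted_hall mu1_ge0 mu2_ge0 hall.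
have plan : transport_plan mu1 mu2 pi.
  (* Hall's theorem only bounds the columns by [mu2]; since the total masses agree, the nonnegative
     gaps sum to 0. *)
  split=> // v; apply/esym/eqP; rewrite -subr_eq0; apply/eqP.
  have gap_ge0 w : true -> 0 <= mu2 w - \sum_u pi u w by rewrite subr_ge0.
  apply: (psumr_eq0P gap_ge0) => //; rewrite sumrB exchange_big -mass.
  by under [X in _ - X]eq_bigr do rewrite row; rewrite subrr.
exists pi => //; rewrite (integral_against_plan f plan).
apply: eq_bigr => u _; apply: eq_bigr => v _.
(* Complementary slackness: either the Lipschitz bound is attained or [pi] vanishes. *)
by have [/eqP -> //|/piG ->] := boolP (G u v); rewrite !mulr0.
Qed.

(* Shifting a potential so that its minimum is 0 bounds it by the diameter,
   so that only finitely many potentials have to be compared. *)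
Lemma exists_optimal_potential (R : realFieldType) (T : finType) (d : T -> T -> nat)
    (nu : T -> R) (x y : T) (f0 : T -> int) :
    \sum_u nu u = 0 -> lipschitz_potential d f0 ->
  exists f, [/\ lipschitz_potential d f, f x - f y = f0 x - f0 y &
    forall g, lipschitz_potential d g -> g x - g y = f0 x - f0 y ->
      integral_against g nu <= integral_against f nu].
Proof.
move=> nu0 lipf0; pose N := \max_(p : T * T) d p.1 p.2.
pose pot (h : {ffun T -> 'I_N.+1}) u : int := (h u : nat)%:Z.
have normalize g : lipschitz_potential d g -> exists2 h, lipschitz_potential d (pot h) &
    pot h x - pot h y = g x - g y /\ integral_against (pot h) nu = integral_against g nu.
  move=> lipg; case: (arg_minP (P := xpredT) g (erefl : xpredT x)) => m _ gm.
  have gE u : (`|g u - g m| < N.+1)%N.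
    rewrite ltnS (@leq_trans (d u m)) //; first by have := lipg u m; have := gm u isT; lia.
    exact: (leq_bigmax (u, m)).
  pose h := [ffun u => Ordinal (gE u)].
  have hE u : pot h u = g u - g m by rewrite /pot ffunE /=; have := gm u isT; lia.
  exists h; first by move=> u v; rewrite !hE; have := lipg u v; lia.
  split; first by rewrite !hE; lia.
  (* A constant shift is invisible to [nu], whose total mass is 0. *)
  rewrite /integral_against; under eq_bigr do rewrite hE intrB mulrBl.
  by rewrite sumrB -mulr_sumr nu0 mulr0 subr0.
pose P h := [forall u, forall v, pot h u - pot h v <= (d u v)%:Z] &&
            (pot h x - pot h y == f0 x - f0 y).
have PP h : reflect (lipschitz_potential d (pot h) /\ pot h x - pot h y = f0 x - f0 y) (P h).
  by apply: (iffP andP) => -[lip /eqP ?]; split=> //;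
    [move=> u v; move/forallP/(_ u)/forallP: lip | apply/forallP => u; apply/forallP => v].
have [h0 liph0 [h0E _]] := normalize _ lipf0.
have Ph0 : P h0 by apply/PP.
case: (arg_maxP (P := P) (fun h => integral_against (pot h) nu) Ph0) => h /PP[liph hE] hmax.
exists (pot h); split=> // g lipg gE; have [k lipk [kE <-]] := normalize _ lipg.
by apply: hmax; apply/PP; rewrite kE.
Qed.

(** * Transport between two lazy measures *)

Definition lazy_mass (R : numDomainType) (T : eqType) (a : R) (x : T) (m : T -> R) u : R :=
  a * (u == x)%:R + (1 - a) * m u.

Lemma sum_lazy_mass (R : numDomainType) (T : finType) (a : R) (x : T) (m : T -> R) :
  \sum_u m u = 1 -> \sum_u lazy_mass a x m u = 1.
Proof.
move=> m1; rewrite big_split /= -!mulr_sumr m1 (bigD1 x) //= eqxx big1 => [|u /negPf -> //].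
by rewrite addr0 !mulr1 addrC subrK.
Qed.

Lemma integral_against_lazy (R : numDomainType) (T : finType) (f : T -> int) (x y : T)
    (mx my : T -> R) (a : R) :
  integral_against f (fun u => lazy_mass a x mx u - lazy_mass a y my u) =
  a * (f x - f y)%:~R + (1 - a) * integral_against f (fun u => mx u - my u).
Proof.
have delta z : \sum_u (f u)%:~R * (u == z)%:R = (f z)%:~R :> R.
  by rewrite (bigD1 z) //= eqxx mulr1 big1 ?addr0 // => u /negPf ->; rewrite mulr0.
rewrite intrB -!delta -sumrB !mulr_sumr -big_split /=.
by apply: eq_bigr => u _; rewrite /lazy_mass; ring.
Qed.

(** The three lines have values [cm], [c0], [c1] at a = 0 and -1, 0, 1 at a = 1, the latter being
    the possible values of f x - f y. *)
Definition max_of_lines (R : realFieldType) (cm c0 c1 a : R) : R :=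
  Num.max (Num.max (- a + (1 - a) * cm) ((1 - a) * c0)) (a + (1 - a) * c1).

(* The witness is the least potential above f with value f y + 1 at x; it
   exceeds f by at most 1 - (f x - f y), and still equals f at y. *)
Lemma raise_potential (R : realFieldType) (T : finType) (d : T -> T -> nat) (x y : T)
    (mx my : T -> R) (f : T -> int) :
    (forall u, d u u = 0%N) -> (forall u v w, (d u w <= d u v + d v w)%N) ->
    d x y = 1%N ->
    (forall u, 0 <= mx u) -> (forall u, 0 <= my u) -> \sum_u my u = 1 ->
    lipschitz_potential d f ->
  exists g, [/\ lipschitz_potential d g, g x - g y = 1 &
    integral_against f (fun u => mx u - my u) + (f x - f y)%:~R - 1 <=
    integral_against g (fun u => mx u - my u)].
Proof.
move=> d0 dtri dxy mx_ge0 my_ge0 my1 lipf.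
pose g u := Num.max (f u) (f y + 1 - (d x u)%:Z).
have fxy : f x - f y <= 1 by have := lipf x y; rewrite dxy.
have gE u : f u <= g u <= f u + 1 - (f x - f y) by rewrite /g; have := lipf x u; lia.
exists g; split.
- move=> u v; rewrite /g; have := lipf u v; have := dtri x u v; lia.
- by rewrite /g d0 dxy; lia.
have : integral_against g (fun u => mx u - my u) - integral_against f (fun u => mx u - my u)
       = \sum_u (g u - f u)%:~R * (mx u - my u).
  by rewrite -sumrB; apply: eq_bigr => u _; rewrite intrB mulrBl.
(* As [g - f] is nonnegative, [mx] can only help; as it is at most 1 - (f x - f y), [my] costs at
   most that much times its total mass 1. *)
have : \sum_u (- (1 - (f x - f y)%:~R) * my u) <= \sum_u (g u - f u)%:~R * (mx u - my u).
  apply: ler_sum => u _; have /andP[fg gf] := gE u.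
  have gf0 : 0 <= (g u - f u)%:~R :> R by rewrite ler0z subr_ge0.
  have gf1 : (g u - f u)%:~R <= 1 - (f x - f y)%:~R :> R.
    by rewrite -(intrB _ 1) ler_int; lia.
  have := mx_ge0 u; have := my_ge0 u; nra.
rewrite -mulr_sumr my1; lra.
Qed.

(* [cm], [c0], [c1] are the maxima of the integral of f against m_x - m_y over
   the potentials f with f x - f y = -1, 0, 1. *)
Lemma lazy_transport_cost (R : realFieldType) (T : finType) (d : T -> T -> nat) (x y : T)
    (mx my : T -> R) :
    (forall u, d u u = 0%N) -> (forall u v w, (d u w <= d u v + d v w)%N) ->
    d x y = 1%N -> d y x = 1%N ->
    (forall u, 0 <= mx u) -> (forall u, 0 <= my u) ->
    \sum_u mx u = 1 -> \sum_u my u = 1 ->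
  exists cm c0 c1, [/\ cm <= c1 + 2, c0 <= c1 + 1 &
    forall a, 0 <= a <= 1 ->
      (exists2 pi, transport_plan (lazy_mass a x mx) (lazy_mass a y my) pi &
         transport_cost d pi = max_of_lines cm c0 c1 a) /\
      (forall pi, transport_plan (lazy_mass a x mx) (lazy_mass a y my) pi ->
         max_of_lines cm c0 c1 a <= transport_cost d pi)].
Proof.
move=> d0 dtri dxy dyx mx_ge0 my_ge0 mx1 my1.
pose nu u := mx u - my u.
have nu0 : \sum_u nu u = 0 by rewrite sumrB mx1 my1 subrr.
(* Explicit potentials showing that each of the differences -1, 0, 1 between x and y occurs, so that
   the three maxima exist. *)
have lipm : lipschitz_potential d (fun u => - (d y u)%:Z).
  by move=> u v; have := dtri y u v; lia.
have lip0 : lipschitz_potential d (fun=> 0) by [].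
have lip1 : lipschitz_potential d (fun u => - (d x u)%:Z).
  by move=> u v; have := dtri x u v; lia.
have [fm [lipfm fmE maxm]] := exists_optimal_potential x y nu0 lipm.
have [f0 [lipf0 f0E max0]] := exists_optimal_potential x y nu0 lip0.
have [f1 [lipf1 f1E max1]] := exists_optimal_potential x y nu0 lip1.
move: fmE maxm f0E max0 f1E max1; rewrite !d0 dxy dyx subr0 !oppr0 sub0r opprK addr0.
move=> fmE maxm f0E max0 f1E max1.
have c1_ge f : lipschitz_potential d f ->
    integral_against f nu + (f x - f y)%:~R - 1 <= integral_against f1 nu.
  move=> lipf; have [g [lipg gE fg]] := raise_potential d0 dtri dxy mx_ge0 my_ge0 my1 lipf.
  exact: le_trans fg (max1 _ lipg gE).
have valE a f := integral_against_lazy f x y mx my a.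
exists (integral_against fm nu), (integral_against f0 nu), (integral_against f1 nu); split.
- by have := c1_ge _ lipfm; rewrite fmE; lra.
- by have := c1_ge _ lipf0; rewrite f0E; lra.
move=> a /andP[a_ge0 a_le1]; set W := max_of_lines _ _ _ a.
have Wge f : lipschitz_potential d f ->
    integral_against f (fun u => lazy_mass a x mx u - lazy_mass a y my u) <= W.
  move=> lipf; rewrite valE -/nu /W /max_of_lines !le_max.
  (* Integrality and distance 1 in both directions leave only three values. *)
  have fxy : f x - f y = -1 \/ f x - f y = 0 \/ f x - f y = 1.
    by have := lipf x y; have := lipf y x; rewrite dxy dyx; lia.
  have a1 : 0 <= 1 - a by lra.
  have [fE|[fE|fE]] := fxy; rewrite fE.
  - by have := ler_wpM2l a1 (maxm f lipf fE); lra.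
  - by have := ler_wpM2l a1 (max0 f lipf fE); lra.
  - by have := ler_wpM2l a1 (max1 f lipf fE); lra.
(* Whichever line is on top, its maximizing potential attains [W] and is thus optimal among all
   potentials. *)
have [f lipf fW] : exists2 f, lipschitz_potential d f &
    integral_against f (fun u => lazy_mass a x mx u - lazy_mass a y my u) = W.
  rewrite /W /max_of_lines; case: leP => _; last case: leP => _.
  - by exists f1; rewrite // valE f1E; ring.
  - by exists f0; rewrite // valE f0E; ring.
  - by exists fm; rewrite // valE fmE; ring.
split=> [|pi plan]; last by rewrite -fW; apply: weak_duality plan.
rewrite -fW; apply: optimal_potential_plan => //.
- by move=> u; rewrite addr_ge0 ?mulr_ge0 ?subr_ge0.
- by move=> u; rewrite addr_ge0 ?mulr_ge0 ?subr_ge0.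
- by rewrite !sum_lazy_mass.
- by move=> g lipg; rewrite fW; apply: Wge.
Qed.

(** * Maxima of three affine functions *)

Lemma affine_piecewise (R : realType) (a b : R) f :
  a < b -> affine_on a b f -> piecewise_affine 1 a b f.
Proof.
by move=> ab fE; exists [:: b]; split=> [|//|[|i] //]; split; rewrite /= ?ab.
Qed.

(** Admitting a = b lets breakpoints coincide, although partition points must strictly increase: a
    degenerate first interval is dropped. *)
Lemma piecewise_affine_cons (R : realType) k (a b c : R) f :
    a <= b -> (a < b -> affine_on a b f) -> piecewise_affine k b c f ->
  piecewise_affine k.+1 a c f.
Proof.
rewrite le_eqVlt => /predU1P[<-|ab] fab [s [[bs lasts] sk fs]].
  by exists s; split=> //; rewrite ltnW.
exists (b :: s); split=> //; first by split=> //=; rewrite ab.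
by move=> [_ /=|i lti]; [exact: fab|exact: fs].
Qed.

(** A maximum of affine functions is convex: each line commutes with convex combinations and lies
    below the maximum at both endpoints. *)
Lemma concave_on_max_of_lines (R : realType) (cm c0 c1 : R) :
  concave_on 0 1 (fun a => 1 - max_of_lines cm c0 c1 a).
Proof.
move=> t a b _ _ /=; rewrite !convRE !opprB lerBlDr /unstable.onem.
have -> : conv t a b = t%:num * a + (1 - t%:num) * b by [].
have : 0 <= t%:num <= 1 by rewrite ge0 le1.
move: (t%:num) => p /andP[p0 p1].
have leW u : [/\ - u + (1 - u) * cm <= max_of_lines cm c0 c1 u,
    (1 - u) * c0 <= max_of_lines cm c0 c1 u & u + (1 - u) * c1 <= max_of_lines cm c0 c1 u].
  by rewrite /max_of_lines !le_max !lexx ?orbT.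
have [am a0 a1] := leW a; have [bm b0 b1] := leW b.
move: (max_of_lines _ _ _ a) (max_of_lines _ _ _ b) am a0 a1 bm b0 b1 => A B am a0 a1 bm b0 b1.
have q1 : 0 <= 1 - p by lra.
rewrite /max_of_lines !ge_max; apply/andP; split; first (apply/andP; split).
- by have := ler_wpM2l p0 am; have := ler_wpM2l q1 bm; lra.
- by have := ler_wpM2l p0 a0; have := ler_wpM2l q1 b0; lra.
- by have := ler_wpM2l p0 a1; have := ler_wpM2l q1 b1; lra.
Qed.

(* The difference of the two lines is affine in a and positive at a = 1. *)
Lemma lines_cross (R : realFieldType) (i j ci cj : R) : i < j ->
  exists2 t, 0 <= t < 1 & forall a, 0 <= a <= 1 ->
    (t <= a -> i * a + (1 - a) * ci <= j * a + (1 - a) * cj) /\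
    (0 < t -> a <= t -> j * a + (1 - a) * cj <= i * a + (1 - a) * ci).
Proof.
move=> ij; have [cij|cji] := leP ci cj.
  (* The line of slope parameter [j] dominates on all of [0, 1]; the guard [0 < t] spares the
     reverse inequality at a = 0, which may fail. *)
  exists 0; first by rewrite lexx ltr01.
  move=> a /andP[a0 a1]; split=> [_|]; last by rewrite ltxx.
  by apply: lerD; [rewrite ler_wpM2r // ltW|rewrite ler_wpM2l // subr_ge0].
have D_gt0 : 0 < (j - i) + (ci - cj) by lra.
(* The zero of the difference of the two lines. *)
exists ((ci - cj) / ((j - i) + (ci - cj))).
  by rewrite divr_ge0 ?ltW //= ?subr_gt0 // ltr_pdivrMr //; lra.
move=> a /andP[a0 a1]; rewrite ler_pdivrMr // ler_pdivlMr //; split=> [|_]; lra.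
Qed.

(** Let [T] be the larger of the points where the third line overtakes the other two. The third line
    is on top after [T], the first before min(t0, T), and the second in between. *)
Lemma piecewise_affine_max_of_lines (R : realType) (cm c0 c1 : R) :
  piecewise_affine 3 0 1 (fun a => 1 - max_of_lines cm c0 c1 a).
Proof.
have [t0 /andP[t0_ge0 t0_lt1] cross0] := @lines_cross R (-1) 0 cm c0 ltac:(lra).
have [t1 /andP[t1_ge0 t1_lt1] cross1] := @lines_cross R (-1) 1 cm c1 ltac:(lra).
have [t2 /andP[t2_ge0 t2_lt1] cross2] := @lines_cross R 0 1 c0 c1 ltac:(lra).
have inT T : t1 <= T -> t2 <= T -> T = t1 \/ T = t2 -> T < 1 ->
    piecewise_affine 3 0 1 (fun a => 1 - max_of_lines cm c0 c1 a).
  move=> t1T t2T TE T1; pose t := Num.min t0 T.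
  have tT : t <= T by rewrite ge_min lexx orbT.
  have t_ge0 : 0 <= t by rewrite le_min t0_ge0 (le_trans t1_ge0).
  apply: (@piecewise_affine_cons _ _ _ t) => // [t_gt0|].
    exists (1 + cm), (1 - cm) => a; rewrite in_itv /= => /andP[a0 at_].
    have [at0 aT] : a <= t0 /\ a <= T by move: at_; rewrite le_min => /andP.
    have t0_gt0 : 0 < t0 by move: t_gt0; rewrite lt_min => /andP[].
    have a01 : 0 <= a <= 1 by lra.
    have [_ /(_ t0_gt0 at0) ?] := cross0 a a01.
    have [_ c1'] := cross1 a a01; have [_ c2'] := cross2 a a01.
    (* If T = t2, the comparison passes through the second line, which is below the first since a <=
       t0. *)
    have ? : a + (1 - a) * c1 <= - a + (1 - a) * cm.
      by case: TE => TE; [have := c1' ltac:(lra) ltac:(lra)|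
                               have := c2' ltac:(lra) ltac:(lra)]; lra.
    by rewrite /max_of_lines max_l max_l; lra.
  apply: (@piecewise_affine_cons _ _ _ T) => // [t_ltT|].
    have tE : t = t0 by move: t_ltT; rewrite gt_min ltxx orbF => /ltW/min_idPl.
    exists c0, (1 - c0) => a; rewrite in_itv /= tE => /andP[a0 aT].
    have a01 : 0 <= a <= 1 by lra.
    have [/(_ a0) ? _] := cross0 a a01.
    have [_ c1'] := cross1 a a01; have [_ c2'] := cross2 a a01.
    (* If T = t1, the comparison passes through the first line, which is below the second since t0
       <= a. *)
    have ? : a + (1 - a) * c1 <= (1 - a) * c0.
      by case: TE => TE; [have := c1' ltac:(lra) ltac:(lra)|
                               have := c2' ltac:(lra) ltac:(lra)]; lra.
    by rewrite /max_of_lines max_l max_r; lra.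
  apply: affine_piecewise => //; exists (c1 - 1), (1 - c1) => a.
  rewrite in_itv /= => /andP[Ta a1]; have a01 : 0 <= a <= 1 by lra.
  have [/(_ (le_trans t1T Ta)) ? _] := cross1 a a01.
  have [/(_ (le_trans t2T Ta)) ? _] := cross2 a a01.
  by rewrite /max_of_lines max_r ?ge_max; lra.
have [t12|/ltW t21] := leP t1 t2.
  by apply: (inT t2) => //; right.
by apply: (inT t1) => //; left.
Qed.

(** The two bounds say exactly that the third line dominates at a = 1/2; it also does at a = 1,
    hence in between. *)
Lemma affine_on_max_of_lines (R : realType) (cm c0 c1 : R) :
  cm <= c1 + 2 -> c0 <= c1 + 1 ->
  affine_on (1 / 2) 1 (fun a => 1 - max_of_lines cm c0 c1 a).
Proof.
move=> cm1 c01; exists (c1 - 1), (1 - c1) => a; rewrite in_itv /= => /andP[a2 a1].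
rewrite /max_of_lines max_r; first by ring.
rewrite ge_max; apply/andP; split; nra.
Qed.

(** * Hypergraphs *)

Local Open Scope classical_set_scope.
Local Open Scope ring_scope.

(** The natural numbers whose infimum is [hdist]; the case u = v builds in its convention d(u, u) =
    0. *)
Definition walk_length (V : choiceType) (H : hypergraph V) (u v : V) (n : nat) : Prop :=
  if u == v then n = 0%N else exists2 p, hyperpath H u v p & size p = n.

(** The concatenation is connected through v but may repeat hyperedges; cutting out its loops makes
    them distinct and only shortens it, hence an inequality on sizes. *)
Lemma hyperpath_cat (V : choiceType) (H : hypergraph V) (u v w : V) p q :
  hyperpath H u v p -> hyperpath H v w q ->
  exists2 r, hyperpath H u w r & (size r <= size p + size q)%N.
Proof.
case: p => [//|e s] [Hp _ ue vs es]; case: q => [//|f r] [Hq _ vf wr fr].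
pose meet g h := ((g `&` h)%fset : {fset V}) != fset0.
have pathc : path meet e (s ++ f :: r).
  rewrite cat_path es /= fr andbT; apply/fset0Pn; exists v.
  by rewrite inE vs vf.
have lastc : last e (s ++ f :: r) = last f r by rewrite last_cat.
case: (shortenP pathc) lastc => r' path_r' uniq_r' sub_r' last_r'.
exists (e :: r'); last first.
  have /andP[_ uniq_tail] := uniq_r'.
  by have := uniq_leq_size uniq_tail sub_r'; rewrite size_cat /= addSn ltnS.
split=> //; last by rewrite last_r'.
move=> g; rewrite inE => /predU1P[->|/sub_r']; first by apply: Hp; rewrite mem_head.
rewrite mem_cat => /orP[gs|gr]; first by apply: Hp; rewrite inE gs orbT.
exact: Hq.
Qed.

Lemma walk_length_trans (V : choiceType) (H : hypergraph V) (u v w : V) m n :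
  walk_length H u v m -> walk_length H v w n ->
  exists2 k, walk_length H u w k & (k <= m + n)%N.
Proof.
rewrite /walk_length; have [<- ->|uv [p puv <-]] := eqVneq u v; first by exists n.
have [<- ->|vw [q qvw <-]] := eqVneq v w.
  by exists (size p); rewrite ?addn0 // (negPf uv); exists p.
have [|uw] := eqVneq u w; first by exists 0%N.
by have [r ruw le_r] := hyperpath_cat puv qvw; exists (size r) => //; exists r.
Qed.

Lemma walk_length_adjacent (V : choiceType) (H : hypergraph V) (u v : V) :
  hadjacent H u v -> walk_length H u v 1.
Proof.
move=> [/eqP/negPf uv [e He [ue ve]]]; rewrite /walk_length uv; exists [:: e] => //.
by split=> // f /[!inE] /eqP ->.
Qed.

Lemma hadjacentC (V : choiceType) (H : hypergraph V) (u v : V) :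
  hadjacent H u v -> hadjacent H v u.
Proof. by move=> [uv [e He [ue ve]]]; split; [exact: nesym|exists e]. Qed.

Lemma hdist_walk_length (R : realType) (V : choiceType) (H : hypergraph V) (u v : V) m :
  walk_length H u v m ->
  exists n, [/\ hdist H R u v = n%:R%:E, walk_length H u v n &
    forall k, walk_length H u v k -> (n <= k)%N].
Proof.
move=> wm; have : exists n, `[< walk_length H u v n >] by exists m; apply/asboolP.
case/ex_minnP => n /asboolP wn nmin; exists n; split=> //; last first.
  by move=> k wk; apply: nmin; apply/asboolP.
move: wn nmin; rewrite /walk_length /hdist.
have [_ -> //|uv [p puv <-] nmin] := eqVneq u v.
apply/eqP; rewrite eq_le; apply/andP; split; first by apply: ereal_inf_lbound; exists p.
apply: le_ereal_inf_tmp => _ [q quv <-]; rewrite lee_fin ler_nat nmin //.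
by apply/asboolP; exists q.
Qed.

(** * Reduction of the Wasserstein distance to a finite vertex set *)

Lemma esum_fset_support (R : realType) (T : choiceType) (S : {fset T}) (F : T -> \bar R) :
    (forall t, t \notin S -> F t = 0%E) -> (forall t, t \in S -> (0 <= F t)%E) ->
  (\esum_(t in [set: T]) F t = \sum_(t : S) F (val t))%E.
Proof.
move=> F0 F_ge0; transitivity (\esum_(t in [set` S]) F t)%E.
  rewrite [RHS]esum_mkcond; apply: eq_esum => t _; case: ifPn => //.
  by rewrite mem_setE => /F0.
rewrite esum_fset //; last by move=> t; rewrite inE; exact: F_ge0.
by rewrite -fsbig_seq ?fset_uniq // big_seq_fsetE.
Qed.

Lemma esum_eq0 (R : realType) (T : choiceType) (F : T -> R) (t : T) :
    (forall s, 0 <= F s) -> (\esum_(s in [set: T]) (F s)%:E = 0)%E ->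
  F t = 0.
Proof.
move=> F_ge0 F0; apply/eqP; rewrite eq_le F_ge0 andbT -lee_fin.
rewrite -[leRHS]/(0%E : \bar R) -F0; apply: esum_ge; exists [set t].
  by split => //; exact: finite_set1.
by rewrite fsbig_set1.
Qed.

(** Marginals supported in [S] force every coupling to vanish off S x S, so couplings restrict to
    plans on [S]; conversely a plan extends by 0. *)
Lemma wasserstein1_fset (R : realType) (V : choiceType) (H : hypergraph V)
    (S : {fset V}) (d : S -> S -> nat) (mu1 mu2 : V -> R) (W : R) :
    (forall u v : S, hdist H R (val u) (val v) = (d u v)%:R%:E) ->
    (forall u, u \notin S -> mu1 u = 0) -> (forall u, u \notin S -> mu2 u = 0) ->
    (forall u, mu1 u <= 1) ->
    (exists2 pi, transport_plan (fun u : S => mu1 (val u)) (fun u : S => mu2 (val u)) pi &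
       transport_cost d pi = W) ->
    (forall pi, transport_plan (fun u : S => mu1 (val u)) (fun u : S => mu2 (val u)) pi ->
       W <= transport_cost d pi) ->
  wasserstein1 H mu1 mu2 = W%:E.
Proof.
move=> dE mu1S mu2S mu1_le1 [pi [pi_ge0 row col] <-] Wle.
(* Distances to vertices outside [S] may be infinite, but there [rho] is 0 and so is the product. *)
have costE (rho : V -> V -> R) :
    (forall u v, 0 <= rho u v) ->
    (forall u v, u \notin S -> rho u v = 0) -> (forall u v, v \notin S -> rho u v = 0) ->
    (\esum_(u in [set: V]) \esum_(v in [set: V]) (hdist H R u v * (rho u v)%:E))%E =
    (transport_cost d (fun u v : S => rho (val u) (val v)))%:E.
  move=> rho_ge0 rhol rhor.
  have inner (u : S) : (\esum_(v in [set: V]) (hdist H R (val u) v * (rho (val u) v)%:E))%E =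
      (\sum_v (d u v)%:R * rho (val u) (val v))%:E.
    rewrite (@esum_fset_support _ _ S) => [|v vS|v vS].
    - by rewrite -sumEFin; apply: eq_bigr => v _; rewrite dE.
    - by rewrite rhor // mule0.
    - by rewrite -[v]/(val [` vS]%fset) dE lee_fin mulr_ge0.
  rewrite (@esum_fset_support _ _ S) => [|u uS|u uS].
  - by rewrite -sumEFin; apply: eq_bigr => u _; rewrite inner.
  - by apply: esum1 => v _; rewrite rhol // mule0.
  - by rewrite -[u]/(val [` uS]%fset) inner lee_fin !sumr_ge0 // => v _; rewrite mulr_ge0.
apply/eqP; rewrite eq_le; apply/andP; split; last first.
  apply: le_ereal_inf_tmp => _ [rho [rho01 rho_row rho_col] <-].
  have rho_ge0 u v : 0 <= rho u v by case/andP: (rho01 u v).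
  have rhol u v : u \notin S -> rho u v = 0.
    by move=> uS; apply: (esum_eq0 (F := rho u)) => //; rewrite rho_row mu1S.
  have rhor u v : v \notin S -> rho u v = 0.
    by move=> vS; apply: (esum_eq0 (F := rho^~ v)) => //; rewrite rho_col mu2S.
  rewrite costE // lee_fin; apply: Wle; split=> // [u|v]; apply: EFin_inj.
    by rewrite -rho_row (@esum_fset_support _ _ S) ?sumEFin // => v;
      [move/rhor ->|rewrite lee_fin].
  by rewrite -rho_col (@esum_fset_support _ _ S) ?sumEFin // => u;
    [move/rhol ->|rewrite lee_fin].
pose rho (u v : V) : R :=
  if (insub u : option S, insub v : option S) is (Some u', Some v') then pi u' v' else 0.
have rhoE (u v : S) : rho (val u) (val v) = pi u v by rewrite /rho !valK.
have rho_ge0 u v : 0 <= rho u v by rewrite /rho; case: (insub u) => [u'|//]; case: (insub v).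
have rhol u v : u \notin S -> rho u v = 0 by move=> uS; rewrite /rho insubN.
have rhor u v : v \notin S -> rho u v = 0.
  by move=> vS; rewrite /rho; case: (insub u) => // u'; rewrite insubN.
have rho_row u : (\esum_(w in [set: V]) (rho u w)%:E = (mu1 u)%:E)%E.
  rewrite (@esum_fset_support _ _ S) => [|v /rhor -> //|v _]; last by rewrite lee_fin.
  rewrite sumEFin; have [uS|uS] := boolP (u \in S).
    congr (_%:E); rewrite -[RHS]/(mu1 (val [` uS]%fset)) -row.
    by apply: eq_bigr => v _; rewrite -rhoE.
  by rewrite mu1S // big1 // => v _; exact: rhol.
have rho_col v : (\esum_(w in [set: V]) (rho w v)%:E = (mu2 v)%:E)%E.
  rewrite (@esum_fset_support _ _ S) => [|u /rhol -> //|u _]; last by rewrite lee_fin.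
  rewrite sumEFin; have [vS|vS] := boolP (v \in S).
    congr (_%:E); rewrite -[RHS]/(mu2 (val [` vS]%fset)) -col.
    by apply: eq_bigr => u _; rewrite -rhoE.
  by rewrite mu2S // big1 // => u _; exact: rhor.
apply: ereal_inf_lbound; exists rho.
  (* An entry is at most its row sum [mu1 u], hence at most 1. *)
  split=> // u v; rewrite rho_ge0 /= (le_trans _ (mu1_le1 u)) //.
  rewrite -lee_fin -rho_row; apply: esum_ge; exists [set v]; last by rewrite fsbig_set1.
  by split => //; exact: finite_set1.
rewrite costE //; congr (_%:E).
by apply: eq_bigr => u _; apply: eq_bigr => v _; rewrite rhoE.
Qed.

(** * The non-lazy random walk *)

Definition walk_mass (R : realType) (V : choiceType) (H : hypergraph V) (x z : V) : R :=
  if z == x then 0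
  else (hdegree H x)%:R^-1 *
    \sum_(e <- fset_set (incident H x) | z \in e) (#|` e|%:R - 1 : R)^-1.

(** If z differs from x and is not adjacent to it, the sum in [walk_mass] is empty, matching the
    value 0 of [lazy_walk]. *)
Lemma lazy_walk_mass (R : realType) (V : choiceType) (H : hypergraph V) (a : R) (x z : V) :
  locally_finite_hypergraph H ->
  lazy_walk H a x z = lazy_mass a x (walk_mass R H x) z.
Proof.
move=> lfH; rewrite /lazy_walk /lazy_mass /walk_mass.
case: eqP => zx /=; first by rewrite mulr0 addr0 mulr1.
rewrite mulr0 add0r mulrA.
have sumE : \sum_(e \in [set e | incident H x e /\ z \in e]) (#|` e|%:R - 1 : R)^-1 =
    \sum_(e <- fset_set (incident H x) | z \in e) (#|` e|%:R - 1 : R)^-1.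
  have -> : [set e | incident H x e /\ z \in e] =
            incident H x `&` [set e : {fset V} | z \in e] by [].
  rewrite fsbig_mkcondr fsbig_finite // [RHS]big_mkcond.
  by apply: eq_bigr => e _; rewrite mem_setE.
case: asboolP => [_|nadj]; first by rewrite sumE.
rewrite big_seq_cond big_pred0 ?mulr0 // => e.
rewrite in_fset_set //; apply/negbTE/negP => /andP[/set_mem[He xe]] ze.
by apply: nadj; split; [exact: nesym|exists e].
Qed.

Lemma walk_mass_ge0 (R : realType) (V : choiceType) (H : hypergraph V) (x z : V) :
  simple_hypergraph H -> locally_finite_hypergraph H -> 0 <= walk_mass R H x z.
Proof.
move=> [card_ge2 _] lfH; rewrite /walk_mass; case: eqP => // _.
rewrite mulr_ge0 ?invr_ge0 // big_seq_cond sumr_ge0 // => e.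
rewrite in_fset_set // => /andP[/set_mem[He _] _].
by rewrite invr_ge0 subr_ge0 ler1n; apply: leq_trans (card_ge2 e He).
Qed.

Lemma walk_mass_eq0 (R : realType) (V : choiceType) (H : hypergraph V) (x z : V) :
  locally_finite_hypergraph H ->
  (forall e, H e -> x \in e -> z \notin e) -> walk_mass R H x z = 0.
Proof.
move=> lfH zN; rewrite /walk_mass; case: eqP => // _.
rewrite big_seq_cond big_pred0 ?mulr0 // => e.
rewrite in_fset_set //; apply/negbTE/negP => /andP[/set_mem[He xe]].
by apply/negP; exact: zN.
Qed.

(** Exchanging sums, each hyperedge e at x gives weight 1/(|e| - 1) to its |e| - 1 other vertices,
    so it contributes 1; [e0] makes the degree nonzero. *)
Lemma sum_walk_mass (R : realType) (V : choiceType) (H : hypergraph V) (x : V)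
    (S : {fset V}) e0 :
    simple_hypergraph H -> locally_finite_hypergraph H -> H e0 -> x \in e0 ->
    (forall e, H e -> x \in e -> (e `<=` S)%fset) ->
  \sum_(z : S) walk_mass R H x (val z) = 1.
Proof.
move=> [card_ge2 _] lfH He0 xe0 eS.
rewrite -(big_seq_fsetE _ S xpredT (walk_mass R H x)) /=.
have edgeE e : e \in fset_set (incident H x) -> H e /\ x \in e.
  by rewrite in_fset_set // inE.
have edge_sum e : e \in fset_set (incident H x) ->
    \sum_(z <- S | (z != x) && (z \in e)) (#|` e|%:R - 1 : R)^-1 = 1.
  move=> /edgeE[He xe]; rewrite big_fset_condE big_const_seq count_predT iter_addr_0.
  have -> : [fset z in S | (z != x) && (z \in e)]%fset = (e `\ x)%fset.
    apply/fsetP => z; rewrite !inE /=.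
    case: (z \in e) (fsubsetP (eS e He xe) z) => // [->//|_].
    by rewrite !andbF.
  have cardE : #|` e| = #|` (e `\ x)%fset|.+1 by rewrite (cardfsD1 x) xe.
  have := card_ge2 e He; rewrite cardE => card_ge1.
  by rewrite -[LHS]mulr_natl -natr1 addrK mulfV // pnatr_eq0; lia.
have deg_neq0 : (hdegree H x)%:R != 0 :> R.
  rewrite pnatr_eq0 -lt0n cardfs_gt0; apply/fset0Pn; exists e0.
  by rewrite in_fset_set // inE.
transitivity ((hdegree H x)%:R^-1 *
    \sum_(e <- fset_set (incident H x))
      \sum_(z <- S | (z != x) && (z \in e)) (#|` e|%:R - 1 : R)^-1).
  rewrite (exchange_big_dep (fun z => z != x)) /= => [|e z _ /andP[] //].
  rewrite mulr_sumr [RHS]big_mkcond; apply: eq_bigr => z _; rewrite /walk_mass.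
  by case: eqP.
rewrite big_seq; under eq_bigr do rewrite edge_sum //.
by rewrite -big_seq big_const_seq count_predT iter_addr_0 mulVf.
Qed.

(** * Curvature of adjacent vertices *)

Theorem theorem1p4 (R : realType) (V : choiceType) (H : hypergraph V)
    (H_locally_finite : locally_finite_hypergraph H)
    (H_simple : simple_hypergraph H)
    (x y : V) (xy_adjacent : hadjacent H x y) :
  exists kappa : R -> R,
    [/\ {in `[0, 1], forall a : R, ollivier_ricci H a x y = (kappa a)%:E},
        concave_on 0 1 kappa,
        piecewise_affine 3 0 1 kappa
      & affine_on (1 / 2) 1 kappa].
Proof.
have [x_neq_y [e0 He0 [xe0 ye0]]] := xy_adjacent.
(* The set [S] below carries both lazy measures, and any two of its vertices are joined by a walk
   through x, so their distance is finite. *)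
pose star z := (\bigcup_(e <- fset_set (incident H z)) e)%fset.
pose S := (star x `|` star y)%fset.
have starP z u : reflect (exists2 e, H e & z \in e /\ u \in e) (u \in star z).
  apply: (iffP (bigfcupP _ _ _ _)) => [[e]|[e He [ze ue]]].
    by rewrite andbT in_fset_set // inE => -[He ze] ue; exists e.
  by exists e; rewrite // andbT in_fset_set // inE.
have sub_star z e : H e -> z \in e -> (e `<=` star z)%fset.
  by move=> He ze; apply/fsubsetP => u ue; apply/starP; exists e.
have xS : x \in S by rewrite inE; apply/orP; left; apply/starP; exists e0.
have yS : y \in S by rewrite inE; apply/orP; left; apply/starP; exists e0.
pose x' : S := [` xS]%fset; pose y' : S := [` yS]%fset.
have star_walk z u : u \in star z ->
    (exists n, walk_length H u z n) /\ (exists n, walk_length H z u n).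
  move=> /starP[e He [ze ue]]; have [->|/eqP uz] := eqVneq u z.
    by rewrite /walk_length eqxx; split; exists 0%N.
  have adj : hadjacent H u z by split=> //; exists e.
  by split; exists 1%N; apply: walk_length_adjacent => //; exact: hadjacentC.
have wtrans u v w : (exists n, walk_length H u v n) -> (exists n, walk_length H v w n) ->
    exists n, walk_length H u w n.
  by move=> [m um] [n vn]; have [k wk _] := walk_length_trans um vn; exists k.
have y_x : y \in star x by apply/starP; exists e0.
have S_walk u : u \in S -> (exists n, walk_length H u x n) /\ (exists n, walk_length H x u n).
  rewrite inE => /orP[/star_walk //|/star_walk[uy yu]].
  by have [yx xy] := star_walk _ _ y_x; split; [exact: wtrans uy yx|exact: wtrans xy yu].
have dist_ex (p : S * S) : exists n, [/\ hdist H R (val p.1) (val p.2) = n%:R%:E,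
    walk_length H (val p.1) (val p.2) n &
    forall k, walk_length H (val p.1) (val p.2) k -> (n <= k)%N].
  have [ux _] := S_walk _ (valP p.1); have [_ xv] := S_walk _ (valP p.2).
  by have [m wm] := wtrans _ _ _ ux xv; exact: hdist_walk_length wm.
(* Distances within [S] become natural numbers; their minimality among walk lengths yields the
   triangle inequality. *)
have [d' dP] := choice dist_ex; pose d u v := d' (u, v).
have dE u v : hdist H R (val u) (val v) = (d u v)%:R%:E by have [] := dP (u, v).
have d_walk u v : walk_length H (val u) (val v) (d u v) by have [] := dP (u, v).
have d_min u v k : walk_length H (val u) (val v) k -> (d u v <= k)%N.
  by have [_ _] := dP (u, v); apply.
have d0 u : d u u = 0%N.
  by have := d_walk u u; rewrite /walk_length eqxx.
have dtri u v w : (d u w <= d u v + d v w)%N.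
  have [k wk] := walk_length_trans (d_walk u v) (d_walk v w).
  exact/leq_trans/d_min.
have d_adj (u v : S) : hadjacent H (val u) (val v) -> d u v = 1%N.
  move=> adj; apply/eqP; rewrite eqn_leq d_min /=; last exact: walk_length_adjacent.
  have := d_walk u v; rewrite /walk_length; case: eqP => [E|_ [[|e p] //= _ <- //]].
  by have [] := adj.
have dxy : d x' y' = 1%N by exact: d_adj.
have dyx : d y' x' = 1%N by apply: d_adj; exact: hadjacentC.
pose m z (u : S) := walk_mass R H z (val u).
have m_ge0 z u : 0 <= m z u by exact: walk_mass_ge0.
have mx1 : \sum_u m x u = 1.
  apply: (@sum_walk_mass _ _ _ _ _ e0) => // e He xe.
  exact: fsubset_trans (sub_star _ _ He xe) (fsubsetUl _ _).
have my1 : \sum_u m y u = 1.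
  apply: (@sum_walk_mass _ _ _ _ _ e0) => // e He ye.
  exact: fsubset_trans (sub_star _ _ He ye) (fsubsetUr _ _).
have [cm [c0 [c1 [cm1 c01 WE]]]] :=
  lazy_transport_cost d0 dtri dxy dyx (m_ge0 x) (m_ge0 y) mx1 my1.
exists (fun a => 1 - max_of_lines cm c0 c1 a); split.
- move=> a; rewrite in_itv /= => a01.
  have lazyE (z : S) :
      (fun u : S => lazy_walk H a (val z) (val u)) = lazy_mass a z (m (val z)).
    by apply/funext => u; rewrite lazy_walk_mass.
  have lazy0 z u : z \in S -> (star z `<=` S)%fset -> u \notin S -> lazy_walk H a z u = 0.
    move=> zS sS uS; rewrite lazy_walk_mass // /lazy_mass.
    have /negPf -> : u != z by apply: contraNneq uS => ->.
    rewrite mulr0 walk_mass_eq0 ?mulr0 ?addr0 // => e He ze.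
    by apply: contra uS => ue; apply: (fsubsetP sS); apply/starP; exists e.
  have sx : (star x `<=` S)%fset by exact: fsubsetUl.
  have sy : (star y `<=` S)%fset by exact: fsubsetUr.
  have [a_ge0 a_le1] := andP a01.
  have lazy_le1 u : lazy_walk H a x u <= 1.
    have [uS|uS] := boolP (u \in S); last by rewrite lazy0.
    rewrite -(sum_lazy_mass a x' mx1) (bigD1 [` uS]%fset) //=.
    rewrite lazy_walk_mass // lerDl sumr_ge0 // => v _.
    by rewrite addr_ge0 ?mulr_ge0 ?subr_ge0.
  have [W1 W2] := WE a a01.
  rewrite /ollivier_ricci (@wasserstein1_fset _ _ _ _ d _ _ (max_of_lines cm c0 c1 a)) //.
  (* Since d(x, y) = 1, the curvature is 1 minus the Wasserstein distance. *)
  + by rewrite -[x]/(val x') -[y]/(val y') dE dxy inver oner_eq0 invr1 mule1.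
  + by move=> u; exact: lazy0.
  + by move=> u; exact: lazy0.
  + by rewrite (lazyE x') (lazyE y').
  + by rewrite (lazyE x') (lazyE y').
- exact: concave_on_max_of_lines.
- exact: piecewise_affine_max_of_lines.
- exact: affine_on_max_of_lines.
Qed.
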